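(* Let $\mathcal{G}$ be a transitive directed acyclic graph (TDAG) on $m$ nodes, and let $Y\in\mathbb{R}^{m\times n}$ be a tuple of $n$ samples. If some row of $Y$, corresponding to node $i$, is a linear combination of the rows corresponding to the parents of $i$, then $Y$ is unstable under the action of $G(\mathcal{G})_{\mathrm{SL}}^{+}$, and the likelihood is unbounded from above. Otherwise, $Y$ is polystable under the action of $G(\mathcal{G})_{\mathrm{SL}}^{+}$ and the MLE given $Y$ exists.
   Context: $\mathcal{G}$ is a directed acyclic graph with nodes $1,\dots,m$; $j\to i$ denotes an edge from $j$ to $i$, and $j$ is then called a parent of $i$. $\mathcal{G}$ is transitive if $k\to j$ and $j\to i$ imply $k\to i$. Define the group $$G(\mathcal{G})=\{g\in\mathrm{GL}_m(\mathbb{R})\mid g_{ij}=0\text{ for all } i\neq j\text{ with } j\not\to i\text{ in }\mathcal{G}\},$$ and let $G(\mathcal{G})_{\mathrm{SL}}^{+}$ be its subgroup of matrices of determinant one, acting on $\mathbb{R}^{m\times n}$ by left multiplication. The columns $Y_1,\dots,Y_n\in\mathbb{R}^m$ of $Y$ are the samples, the rows of $Y$ correspond to the nodes. A zero row is interpreted as a (trivial) linear combination of any set of rows, including the empty set. The Gaussian graphical model is $\mathcal{M}_{\mathcal{G}}^{\to}=\{(I-\Lambda)^{\mathsf T}\Omega^{-1}(I-\Lambda)\}$, where $\Lambda\in\mathbb{R}^{m\times m}$ satisfies $\Lambda_{ij}=0$ whenever $j\not\to i$ (in particular zero diagonal), and $\Omega$ is diagonal positive definite; for a TDAG it equals $\{g^{\mathsf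 T}g\mid g\in G(\mathcal{G})\}$. The log-likelihood is $\ell_Y(\Psi)=\log\det(\Psi)-\mathrm{tr}(\Psi S_Y)$, $S_Y=\frac1n\sum_{i=1}^nY_iY_i^{\mathsf T}$, for $\Psi\in\mathcal{M}_{\mathcal{G}}^{\to}$ (up to additive and multiplicative constants the logarithm of the likelihood, so one is bounded from above iff the other is). An MLE given $Y$ is a matrix in $\mathcal{M}_{\mathcal{G}}^{\to}$ at which $\ell_Y$ attains its maximum over the model. Stability notions for a group $H$ acting linearly on a vector space $W$ and $v\in W$ (Euclidean closures): $v$ is unstable if $0\in\overline{H\cdot v}$; polystable if $v\neq0$ and $H\cdot v$ is closed. *)

(* Defs.v *)
From mathcomp Require Import all_boot all_order all_algebra.
From mathcomp Require Import all_classical all_reals all_analysis.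
Set Implicit Arguments.
Unset Strict Implicit.
Unset Printing Implicit Defensive.
Import Order.TTheory GRing.Theory Num.Theory.
Import numFieldTopology.Exports numFieldNormedType.Exports.
Local Open Scope classical_set_scope.
Local Open Scope ring_scope.

(* A directed graph on m nodes is a relation e on 'I_m; e j i is the edge
   j -> i, i.e. j is a parent of i. *)

Definition acyclic (m : nat) (e : rel 'I_m) : Prop :=
  forall c : seq 'I_m, cycle e c -> c = [::].

Definition tdag (m : nat) (e : rel 'I_m) : Prop :=
  acyclic e /\ transitive e.

Definition dag_group (R : realType) (m : nat) (e : rel 'I_m) : set 'M[R]_m :=
  [set g | g \in unitmx /\
           forall i j : 'I_m, i != j -> ~~ e j i -> g i j = 0].

Definition dag_group_SL (R : realType) (m : nat) (e : rel 'I_m)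
    : set 'M[R]_m :=
  [set g | dag_group e g /\ \det g = 1].

(* Topological notions below refer to the library topology on matrices, which
   is the entrywise (Euclidean) one. *)

Definition left_orbit (R : realType) (m n : nat) (H : set 'M[R]_m)
    (Y : 'M[R]_(m, n)) : set 'M[R]_(m, n) :=
  [set g *m Y | g in H].

Definition unstable (R : realType) (m n : nat) (H : set 'M[R]_m)
    (Y : 'M[R]_(m, n)) : Prop :=
  closure (left_orbit H Y) 0.

Definition polystable (R : realType) (m n : nat) (H : set 'M[R]_m)
    (Y : 'M[R]_(m, n)) : Prop :=
  Y <> 0 /\ closed (left_orbit H Y).

Definition posdefmx (R : realType) (m : nat) (A : 'M[R]_m) : Prop :=
  A^T = A /\ forall x : 'cV[R]_m, x != 0 -> 0 < (x^T *m A *m x) 0 0.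

(* Since e is irreflexive when acyclic, the support condition on Lambda
   includes a zero diagonal. *)
Definition gaussian_model (R : realType) (m : nat) (e : rel 'I_m)
    : set 'M[R]_m :=
  [set Psi | exists Lambda Omega : 'M[R]_m,
    [/\ forall i j : 'I_m, ~~ e j i -> Lambda i j = 0,
        is_diag_mx Omega,
        posdefmx Omega &
        Psi = (1%:M - Lambda)^T *m invmx Omega *m (1%:M - Lambda)]].

Definition sample_cov (R : realType) (m n : nat) (Y : 'M[R]_(m, n))
    : 'M[R]_m :=
  n%:R^-1 *: \sum_(k < n) col k Y *m (col k Y)^T.

Definition log_likelihood (R : realType) (m n : nat) (Y : 'M[R]_(m, n))
    (Psi : 'M[R]_m) : R :=
  ln (\det Psi) - \tr (Psi *m sample_cov Y).

Definition likelihood_unbounded (R : realType) (m n : nat) (e : rel 'I_m)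
    (Y : 'M[R]_(m, n)) : Prop :=
  forall M : R, exists2 Psi, gaussian_model e Psi & M < log_likelihood Y Psi.

Definition is_MLE (R : realType) (m n : nat) (e : rel 'I_m)
    (Y : 'M[R]_(m, n)) (Psi : 'M[R]_m) : Prop :=
  gaussian_model e Psi /\
  forall Psi', gaussian_model e Psi' ->
    log_likelihood Y Psi' <= log_likelihood Y Psi.

(* For a node without parents the sum is empty, so the condition reads
   row i Y = 0. *)
Definition row_in_parent_span (R : realType) (m n : nat) (e : rel 'I_m)
    (Y : 'M[R]_(m, n)) (i : 'I_m) : Prop :=
  exists c : 'I_m -> R, row i Y = \sum_(j < m | e j i) c j *: row j Y.

(* Main.v *)
Require Import Defs.
From mathcomp Require Import all_boot all_order all_algebra all_fingroup.
From mathcomp Require Import all_classical all_reals all_analysis.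
From mathcomp Require Import lra.
Set Implicit Arguments.
Unset Strict Implicit.
Unset Printing Implicit Defensive.
Import Order.TTheory GRing.Theory Num.Theory.
Import numFieldTopology.Exports numFieldNormedType.Exports.
Local Open Scope classical_set_scope.
Local Open Scope ring_scope.

(** Acyclicity makes every matrix g of the group triangular up to relabelling,
    so det g is the product of its diagonal entries, and each row of [g *m Y]
    depends only on the matching row of g: it is [g i i] times row i of Y plus a
    combination of the parent rows. Hence both problems decouple over the nodes.
    If row i is a combination of its parents, a row operation kills it; then all
    other rows can be scaled to 0 while row i of g absorbs the determinant, and
    the conditional variance of node i can be sent to 0 at no cost. Otherwise the
    least squares residual of row i on its parents is nonzero: it yields the
    equations of the orbit, and explicit maximizers of the likelihood. *)

Definition dag_supported (F : nmodType) (m : nat) (e : rel 'I_m)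
    (g : 'M[F]_m) : Prop :=
  forall i j : 'I_m, i != j -> ~~ e j i -> g i j = 0.

Definition parent_rows (F : nmodType) (m n : nat) (e : rel 'I_m)
    (Y : 'M[F]_(m, n)) (i : 'I_m) : 'M[F]_(m, n) :=
  \matrix_j (if e j i then row j Y else 0).

Definition sqnorm (F : pzRingType) (n : nat) (q : 'rV[F]_n) : F :=
  (q *m q^T) 0 0.

Lemma tdag_irreflexive (m : nat) (e : rel 'I_m) :
  tdag e -> irreflexive e.
Proof.
case=> acyc _ i; apply/negP => eii.
by have := acyc [:: i]; rewrite /= eii => /(_ isT).
Qed.

Lemma perm_tdag_id (m : nat) (e : rel 'I_m) (s : {perm 'I_m}) :
  tdag e -> (forall k, s k != k -> e (s k) k) -> s = 1%g.
Proof.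
move=> e_tdag es; apply/permP => i; rewrite perm1; apply/eqP/negPn/negP => si.
have sX k : (s ^+ k)%g i != s ((s ^+ k)%g i).
  rewrite -permM -expgSr expgS permM eq_sym.
  by rewrite (inj_eq perm_inj).
have eX k : e ((s ^+ k.+1)%g i) i.
  elim: k => [|k IHk]; first exact: es.
  rewrite expgSr permM; case: e_tdag => _ tr; apply: tr IHk.
  by apply: es; rewrite eq_sym.
have := eX #[s]%g.-1; rewrite prednK ?order_gt0 // expg_order perm1.
by rewrite tdag_irreflexive.
Qed.

(* In the Leibniz expansion only the identity contributes: a permutation with
   nonzero product moves indices along edges only, and its cycles would be
   cycles of the graph. *)
Lemma det_dag_supported (F : comPzRingType) (m : nat) (e : rel 'I_m)
    (g : 'M[F]_m) :
  tdag e -> dag_supported e g -> \det g = \prod_i g i i.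
Proof.
move=> e_tdag g_supp; rewrite /determinant (bigD1 1%g) //= odd_perm1 mul1r.
under eq_bigr do rewrite perm1.
rewrite [X in _ + X]big1 ?addr0 // => s s1.
have [k sk esk] : exists2 k, s k != k & ~~ e (s k) k.
  apply/exists2P; apply: contrapT => /forallNP noedge.
  case/eqP: s1; apply: perm_tdag_id e_tdag _ => k sk.
  by apply: contrapT => /negP esk; apply: (noedge k).
by rewrite (bigD1 k) //= g_supp ?mul0r ?mulr0 // eq_sym.
Qed.

Lemma sqnormE (F : pzRingType) (n : nat) (q : 'rV[F]_n) :
  sqnorm q = \sum_j q 0 j ^+ 2.
Proof. by rewrite /sqnorm mxE; apply: eq_bigr => j _; rewrite !mxE expr2. Qed.

Lemma sqnorm_ge0 (F : realDomainType) (n : nat) (q : 'rV[F]_n) : 0 <= sqnorm q.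
Proof. by rewrite sqnormE sumr_ge0 // => j _; rewrite sqr_ge0. Qed.

Lemma sqnorm_eq0 (F : realDomainType) (n : nat) (q : 'rV[F]_n) :
  (sqnorm q == 0) = (q == 0).
Proof.
apply/idP/eqP => [|->]; last by rewrite /sqnorm mul0mx mxE.
rewrite sqnormE psumr_eq0 => [/allP q0|j _]; last exact: sqr_ge0.
apply/rowP => j; rewrite mxE; apply/eqP.
by have := q0 j (mem_index_enum _); rewrite sqrf_eq0.
Qed.

Lemma sqnormD_orthogonal (F : comPzRingType) (n : nat) (q r : 'rV[F]_n) :
  q *m r^T = 0 -> sqnorm (q + r) = sqnorm q + sqnorm r.
Proof.
move=> qr; have rq : r *m q^T = 0 by rewrite -[r]trmxK -trmx_mul qr trmx0.
by rewrite /sqnorm linearD /= mulmxDl !mulmxDr qr rq add0r addr0 mxE.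
Qed.

Lemma mxrank_gram (F : realFieldType) (p n : nat) (A : 'M[F]_(p, n)) :
  \rank (A *m A^T) = \rank A.
Proof.
apply/eqP; rewrite eqn_leq mxrankM_maxl /=.
have sub : (kermx (A *m A^T) <= kermx A)%MS.
  apply/row_subP => k; set v := row k _.
  have v0 : v *m (A *m A^T) = 0.
    by apply: sub_kermxP; rewrite row_sub.
  apply/sub_kermxP/eqP; rewrite -sqnorm_eq0 /sqnorm trmx_mul mulmxA.
  by rewrite -[v *m A *m _]mulmxA v0 mul0mx mxE.
have := mxrankS sub; rewrite !mxrank_ker leq_sub2lE //; exact: rank_leq_row.
Qed.

Lemma exists_orthogonal_residual (F : realFieldType) (p n : nat)
    (A : 'M[F]_(p, n)) (y : 'rV[F]_n) :
  exists c : 'rV[F]_p, (y - c *m A) *m A^T = 0.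
Proof.
have /submxP[c yc] : (y *m A^T <= A *m A^T)%MS.
  apply: submx_trans (submxMl _ _) _.
  by rewrite -(geq_leqif (mxrank_leqif_sup (submxMl A A^T))) mxrank_gram mxrank_tr.
by exists c; rewrite mulmxBl yc mulmxA subrr.
Qed.

Lemma mul_parent_rows (F : pzRingType) (m n : nat) (e : rel 'I_m)
    (Y : 'M[F]_(m, n)) (i : 'I_m) (c : 'rV[F]_m) :
  c *m parent_rows e Y i = \sum_(j < m | e j i) c 0 j *: row j Y.
Proof.
rewrite mulmx_sum_row [RHS]big_mkcond /=; apply: eq_bigr => j _.
by rewrite rowK; case: ifP; rewrite ?scaler0.
Qed.

Lemma row_mul_dag_supported (F : pzRingType) (m n : nat) (e : rel 'I_m)
    (g : 'M[F]_m) (Y : 'M[F]_(m, n)) (i : 'I_m) :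
  irreflexive e -> dag_supported e g ->
  row i (g *m Y) = g i i *: row i Y + row i g *m parent_rows e Y i.
Proof.
move=> irr g_supp; rewrite row_mul mulmx_sum_row (bigD1 i) //= mxE.
congr (_ + _); rewrite mul_parent_rows big_mkcond [RHS]big_mkcond /=.
apply: eq_bigr => j _; case: eqVneq => [->|ij] /=; first by rewrite irr.
by case: ifPn => // eji; rewrite mxE g_supp ?scale0r // eq_sym.
Qed.

Lemma row_in_parent_spanP (R : realType) (m n : nat) (e : rel 'I_m)
    (Y : 'M[R]_(m, n)) (i : 'I_m) :
  row_in_parent_span e Y i <->
  exists c : 'rV[R]_m, row i Y = c *m parent_rows e Y i.
Proof.
split=> -[c yc]; last by exists (c 0); rewrite -mul_parent_rows.
exists (\row_j c j); rewrite yc mul_parent_rows.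
by apply: eq_bigr => j _; rewrite mxE.
Qed.

Lemma exists_parent_residual (R : realType) (m n : nat) (e : rel 'I_m)
    (Y : 'M[R]_(m, n)) (i : 'I_m) :
  ~ row_in_parent_span e Y i ->
  exists (c : 'rV[R]_m) (q : 'rV[R]_n),
    [/\ row i Y = q + c *m parent_rows e Y i,
        q *m (parent_rows e Y i)^T = 0 & 0 < sqnorm q].
Proof.
move=> nspan; have [c qA] := exists_orthogonal_residual (parent_rows e Y i) (row i Y).
exists c, (row i Y - c *m parent_rows e Y i); split=> //; first by rewrite subrK.
rewrite lt0r sqnorm_ge0 sqnorm_eq0 andbT subr_eq0.
by apply/eqP => yc; apply/nspan/row_in_parent_spanP; exists c.
Qed.

Lemma diag_posdefmx (R : realType) (m : nat) (w : 'rV[R]_m) :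
  (forall i, 0 < w 0 i) -> posdefmx (diag_mx w).
Proof.
move=> w_gt0; split=> [|x x0]; first exact: tr_diag_mx.
have -> : (x^T *m diag_mx w *m x) 0 0 = \sum_i w 0 i * x i 0 ^+ 2.
  rewrite mxE; apply: eq_bigr => i _; rewrite mul_mx_diag !mxE.
  by rewrite mulrAC mulrC expr2.
have [i xi] : exists i, x i 0 != 0.
  by apply/cV0Pn; move: x0; apply: contra_neq.
rewrite (bigD1 i) //= ltr_wpDr ?sumr_ge0 // => [j _|].
  by rewrite mulr_ge0 ?sqr_ge0 // ltW.
by rewrite mulr_gt0 // exprn_even_gt0.
Qed.

Lemma posdefmx_diag_gt0 (R : realType) (m : nat) (A : 'M[R]_m) (i : 'I_m) :
  posdefmx A -> 0 < A i i.
Proof.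
move=> [_ /(_ (delta_mx i 0))]; rewrite trmx_delta -rowE => Apos.
have := Apos _; rewrite -colE !mxE; apply.
apply/eqP => /matrixP/(_ i 0); rewrite !mxE !eqxx => /eqP.
by rewrite oner_eq0.
Qed.

Lemma invmx_diag (F : fieldType) (m : nat) (w : 'rV[F]_m) :
  (forall i, w 0 i != 0) -> invmx (diag_mx w) = diag_mx (\row_i (w 0 i)^-1).
Proof.
move=> w0; set V := diag_mx (\row__ _).
have wV : diag_mx w *m V = 1%:M.
  rewrite mulmx_diag -diag_const_mx; congr diag_mx.
  by apply/rowP => i; rewrite !mxE mulfV.
have [wu _] := mulmx1_unit wV.
by rewrite -[RHS](mulKmx wu) wV mulmx1.
Qed.

Lemma gaussian_modelP (R : realType) (m : nat) (e : rel 'I_m) (Psi : 'M[R]_m) :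
  gaussian_model e Psi <->
  exists (L : 'M[R]_m) (w : 'rV[R]_m),
    [/\ forall i j, ~~ e j i -> L i j = 0, forall i, 0 < w 0 i &
        Psi = (1%:M - L)^T *m diag_mx w *m (1%:M - L)].
Proof.
split=> [[L [Om [L0 /is_diag_mxP Omd Ompos ->]]]|[L [w [L0 w_gt0 ->]]]].
  have OmE : Om = diag_mx (\row_i Om i i).
    apply/matrixP => i j; rewrite !mxE.
    by case: eqVneq => [->|ij]; rewrite ?mulr1n // Omd.
  have Omi i : 0 < Om i i by exact: posdefmx_diag_gt0.
  exists L, (\row_i (Om i i)^-1); split=> // [i|]; first by rewrite mxE invr_gt0.
  rewrite OmE invmx_diag => [|i]; last by rewrite mxE gt_eqF.
  congr (_ *m diag_mx _ *m _); apply/rowP => i.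
  by rewrite !mxE eqxx mulr1n.
exists L, (diag_mx (\row_i (w 0 i)^-1)); split=> //.
- by apply: diag_posdefmx => i; rewrite mxE invr_gt0.
- rewrite invmx_diag => [|i]; last by rewrite mxE gt_eqF // invr_gt0.
  by congr (_ *m diag_mx _ *m _); apply/rowP => i; rewrite !mxE invrK.
Qed.

Lemma sample_covE (R : realType) (m n : nat) (Y : 'M[R]_(m, n)) :
  sample_cov Y = n%:R^-1 *: (Y *m Y^T).
Proof.
congr (_ *: _); apply/matrixP => i j; rewrite summxE mxE.
by apply: eq_bigr => k _; rewrite mxE big_ord1 !mxE.
Qed.

Lemma ln_prod (R : realType) (m : nat) (f : 'I_m -> R) :
  (forall i, 0 < f i) -> ln (\prod_i f i) = \sum_i ln (f i).
Proof.
move=> f_gt0.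
suff [] : 0 < \prod_i f i /\ ln (\prod_i f i) = \sum_i ln (f i) by [].
apply: (big_ind2 (fun x y => 0 < x /\ ln x = y)) => [|x y x' y'|//].
  by rewrite ltr01 ln1.
by move=> [x0 <-] [x0' <-]; rewrite mulr_gt0 // lnM.
Qed.

Lemma one_sub_dag_supported (F : pzRingType) (m : nat) (e : rel 'I_m)
    (L : 'M[F]_m) :
  (forall i j, ~~ e j i -> L i j = 0) -> dag_supported e (1%:M - L).
Proof. by move=> L0 i j /negPf ij eji; rewrite !mxE ij L0 ?subr0. Qed.

Lemma log_likelihoodE (R : realType) (m n : nat) (e : rel 'I_m)
    (Y : 'M[R]_(m, n)) (L : 'M[R]_m) (w : 'rV[R]_m) :
  tdag e -> (forall i j, ~~ e j i -> L i j = 0) -> (forall i, 0 < w 0 i) ->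
  log_likelihood Y ((1%:M - L)^T *m diag_mx w *m (1%:M - L)) =
  \sum_i (ln (w 0 i) - w 0 i *
     (n%:R^-1 * sqnorm (row i Y - row i L *m parent_rows e Y i))).
Proof.
move=> e_tdag L0 w_gt0; have irr := tdag_irreflexive e_tdag.
set B := 1%:M - L; have Bs : dag_supported e B := one_sub_dag_supported L0.
have Bii i : B i i = 1 by rewrite !mxE eqxx L0 ?irr // subr0.
have detB : \det B = 1.
  by rewrite (det_dag_supported e_tdag Bs) big1.
rewrite sumrB /log_likelihood !det_mulmx det_tr detB mul1r mulr1 det_diag ln_prod //.
congr (_ - _); rewrite sample_covE -scalemxAr mxtraceZ.
rewrite mxtrace_mulC !mulmxA mxtrace_mulC !mulmxA -[B *m Y *m _ *m _]mulmxA -trmx_mul.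
rewrite mulr_sumr; apply: eq_bigr => i _.
have -> : row i Y - row i L *m parent_rows e Y i = row i (B *m Y).
  rewrite (row_mul_dag_supported _ _ irr Bs) Bii scale1r; congr (_ + _).
  rewrite /B linearB /= mulmxBl mul_parent_rows big1 ?add0r // => j eji.
  by rewrite !mxE; case: eqVneq eji => [->|_]; rewrite ?irr ?scale0r.
rewrite mul_mx_diag mxE [RHS]mulrCA; congr (_ * _).
rewrite mulrC; congr (_ * _); rewrite /sqnorm !mxE.
by apply: eq_bigr => k _; rewrite !mxE.
Qed.

Lemma log_likelihood_unbounded (R : realType) (m n : nat) (e : rel 'I_m)
    (Y : 'M[R]_(m, n)) (i : 'I_m) :
  tdag e -> row_in_parent_span e Y i -> likelihood_unbounded e Y.
Proof.
move=> e_tdag /row_in_parent_spanP[c yc] M.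
pose L : 'M[R]_m := \matrix_(k, j) (if (k == i) && e j k then c 0 j else 0).
have L0 k j : ~~ e j k -> L k j = 0 by move=> /negPf ejk; rewrite mxE ejk andbF.
have Li : row i L *m parent_rows e Y i = row i Y.
  rewrite yc !mul_parent_rows; apply: eq_bigr => j eji.
  by rewrite !mxE eqxx eji.
pose r k := n%:R^-1 * sqnorm (row k Y - row k L *m parent_rows e Y k).
pose K := \sum_(k | k != i) r k.
pose w : 'rV[R]_m := \row_k (if k == i then expR (M + K + 1) else 1).
have w_gt0 k : 0 < w 0 k by rewrite mxE; case: ifP; rewrite ?expR_gt0.
exists ((1%:M - L)^T *m diag_mx w *m (1%:M - L)).
  by apply/gaussian_modelP; exists L, w.
rewrite (log_likelihoodE Y e_tdag L0 w_gt0) (bigD1 i) //= Li subrr.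
have -> : sqnorm (0 : 'rV[R]_n) = 0 by apply/eqP; rewrite sqnorm_eq0.
rewrite !mulr0 subr0 mxE eqxx expRK.
rewrite (eq_bigr (fun k => - r k)) => [|k /negPf ki]; last first.
  by rewrite mxE ki ln1 mul1r sub0r.
by rewrite sumrN -/K addrAC addrK ltrDl.
Qed.

(* Node by node: with [d] the least squares residual, the term of a node with
   weight [w] is at most [ln w - w d <= - ln d - 1], with equality at
   [w = 1 / d]. *)
Lemma MLE_exists (R : realType) (m n : nat) (e : rel 'I_m)
    (Y : 'M[R]_(m, n)) :
  (0 < n)%N -> tdag e -> (forall i, ~ row_in_parent_span e Y i) ->
  exists Psi, is_MLE e Y Psi.
Proof.
move=> n_gt0 e_tdag nspan; have irr := tdag_irreflexive e_tdag.
have /choice[c /choice[q cq]] := fun i => exists_parent_residual (nspan i).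
pose d i := n%:R^-1 * sqnorm (q i).
have ninv_gt0 : 0 < n%:R^-1 :> R by rewrite invr_gt0 ltr0n.
have d_gt0 i : 0 < d i by have [_ _ q0] := cq i; rewrite mulr_gt0.
pose L : 'M[R]_m := \matrix_(k, j) (if e j k then c k 0 j else 0).
have L0 k j : ~~ e j k -> L k j = 0 by move=> /negPf ejk; rewrite mxE ejk.
pose w : 'rV[R]_m := \row_k (d k)^-1.
have w_gt0 k : 0 < w 0 k by rewrite mxE invr_gt0.
exists ((1%:M - L)^T *m diag_mx w *m (1%:M - L)); split.
  by apply/gaussian_modelP; exists L, w.
move=> _ /gaussian_modelP[L' [w' [L'0 w'_gt0 ->]]].
rewrite (log_likelihoodE Y e_tdag L0 w_gt0) (log_likelihoodE Y e_tdag L'0 w'_gt0).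
apply: ler_sum => i _; have [yq qA _] := cq i.
have -> : row i Y - row i L *m parent_rows e Y i = q i.
  rewrite yq (_ : row i L *m _ = c i *m parent_rows e Y i) ?addrK //.
  by rewrite !mul_parent_rows; apply: eq_bigr => j eji; rewrite !mxE eji.
rewrite -/(d i) [in leRHS]mxE mulVf ?gt_eqF // lnV ?posrE //.
have res_ge : d i <=
    n%:R^-1 * sqnorm (row i Y - row i L' *m parent_rows e Y i).
  rewrite ler_pM2l // yq -addrA -mulmxBl sqnormD_orthogonal ?lerDl ?sqnorm_ge0 //.
  by rewrite trmx_mul mulmxA qA mul0mx.
apply: (@le_trans _ _ (ln (w' 0 i) - w' 0 i * d i)).
  by rewrite lerB // ler_pM2l.
have : ln (w' 0 i * d i) <= w' 0 i * d i - 1.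
  have := @le_ln1Dx R (w' 0 i * d i - 1).
  by rewrite subrKC; apply; rewrite ltrBrDl subrr mulr_gt0.
rewrite lnM ?posrE //; lra.
Qed.

Lemma unstable_row_in_parent_span (R : realType) (m n : nat) (e : rel 'I_m)
    (Y : 'M[R]_(m, n)) (i : 'I_m) :
  tdag e -> row_in_parent_span e Y i ->
  unstable (dag_group_SL (R := R) e) Y.
Proof.
move=> e_tdag /row_in_parent_spanP[c yc]; have irr := tdag_irreflexive e_tdag.
pose Y0 : 'M[R]_(m, n) := \matrix_k (if k == i then 0 else row k Y).
have in_orbit t : 0 < t -> left_orbit (dag_group_SL (R := R) e) Y (t *: Y0).
  move=> t_gt0; pose a k := if k == i then (t ^+ m.-1)^-1 else t.
  pose g : 'M[R]_m := \matrix_(k, j)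
    (a k * (if j == k then 1 else if (k == i) && e j k then - c 0 j else 0)).
  have gs : dag_supported e g.
    move=> k j /negPf kj /negPf ejk.
    by rewrite mxE eq_sym kj ejk andbF mulr0.
  have gkk k : g k k = a k by rewrite mxE eqxx mulr1.
  have detg : \det g = 1.
    rewrite (det_dag_supported e_tdag gs) (bigD1 i) //= gkk /a eqxx.
    rewrite (eq_bigr (fun=> t)) => [|k /negPf ki]; last by rewrite gkk /a ki.
    by rewrite prodr_const cardC1 card_ord mulVf // expf_neq0 // gt_eqF.
  exists g.
    by split=> //; split=> //; rewrite unitmxE detg unitr1.
  apply/row_matrixP => k; rewrite (row_mul_dag_supported _ _ irr gs) gkk.
  rewrite linearZ /= rowK mul_parent_rows; case: eqVneq => [->|ki].
    rewrite scaler0 yc mul_parent_rows scaler_sumr -big_split /= big1 // => j eji.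
    rewrite !mxE eqxx eji /=; case: eqVneq eji => [->|_ _]; first by rewrite irr.
    by rewrite mulrN scaleNr scalerA subrr.
  rewrite /a (negPf ki) big1 ?addr0 // => j ejk; rewrite !mxE (negPf ki) /=.
  by case: eqVneq ejk => [->|_ _]; rewrite ?irr // mulr0 scale0r.
move=> B B0.
have scale_cvg : t *: Y0 @[t --> (0 : R)^'+] --> (0 : 'M[R]_(m, n)).
  rewrite -[X in _ --> X](scale0r Y0); apply: cvgZr_tmp.
  exact: cvg_at_right_filter.
have tB : \forall t \near (0 : R)^'+, B (t *: Y0) := scale_cvg B B0.
have [t [Bt t_gt0]] := filter_ex (filterI tB (nbhs_right_gt (0 : R))).
by exists (t *: Y0); split=> //; exact: in_orbit.
Qed.

Lemma row_mulmx_continuous (R : realType) (m n p : nat) (P : 'M[R]_(n, p))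
    (i : 'I_m) (k : 'I_p) :
  continuous (fun Z : 'M[R]_(m, n) => (row i Z *m P) 0 k).
Proof.
have -> : (fun Z : 'M[R]_(m, n) => (row i Z *m P) 0 k) =
          (fun Z => \sum_j Z i j * P j k).
  by apply/funext => Z; rewrite mxE; apply: eq_bigr => j _; rewrite mxE.
apply: continuous_big => [|j _ Z]; first exact: add_continuous.
apply: cvgM; [exact: nbhs_filter|exact: coord_continuous|exact: (@cvg_cst _ _ _ _ (nbhs_filter Z))].
Qed.

Lemma closed_fiber (R : realType) (T : topologicalType) (f : T -> R) (a : R) :
  continuous f -> closed [set x | f x = a].
Proof.
move=> f_cont; apply: (@preimage_closed _ _ f [set y | y = a]).
  by move=> x _; exact: f_cont.
exact: closed_eq.
Qed.

Lemma exists_dual_vector (R : realType) (m n : nat) (e : rel 'I_m)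
    (Y : 'M[R]_(m, n)) (i : 'I_m) :
  ~ row_in_parent_span e Y i ->
  exists w : 'cV[R]_n, parent_rows e Y i *m w = 0 /\ row i Y *m w = 1%:M.
Proof.
move=> /exists_parent_residual[c [q [yq qA q_gt0]]].
have Aq : parent_rows e Y i *m q^T = 0.
  by rewrite -[parent_rows _ _ _]trmxK -trmx_mul qA trmx0.
exists ((sqnorm q)^-1 *: q^T); split; rewrite -scalemxAr ?Aq ?scaler0 //.
rewrite yq mulmxDl -mulmxA Aq mulmx0 addr0 [q *m _]mx11_scalar -/(sqnorm q).
by rewrite scale_scalar_mx mulVf // gt_eqF.
Qed.

(* With [w i] dual to row i of Y modulo the parent rows, the orbit is cut out by
   polynomial equations: row i of Z lies in the span of row i of Y (with
   coefficient [row i Z *m w i]) and the parent rows, and the product of these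
   coefficients is 1. *)
Lemma closed_dag_orbit (R : realType) (m n : nat) (e : rel 'I_m)
    (Y : 'M[R]_(m, n)) :
  tdag e -> (forall i, ~ row_in_parent_span e Y i) ->
  closed (left_orbit (dag_group_SL (R := R) e) Y).
Proof.
move=> e_tdag nspan; have irr := tdag_irreflexive e_tdag.
have /choice[w wP] := fun i => exists_dual_vector (nspan i).
pose P i := (1%:M - w i *m row i Y) *m cokermx (parent_rows e Y i).
have -> : left_orbit (dag_group_SL (R := R) e) Y =
    (\bigcap_(i in [set: 'I_m]) \bigcap_(k in [set: 'I_n])
      [set Z : 'M[R]_(m, n) | (row i Z *m P i) 0 k = 0]) `&`
    [set Z : 'M[R]_(m, n) | \prod_i (row i Z *m w i) 0 0 = 1].
  apply/seteqP; split=> [_ [g [[gu gs] detg] <-]|Z [ZP Zw]].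
    have gYw i : row i (g *m Y) *m w i = (g i i)%:M.
      have [Aw yw] := wP i; rewrite (row_mul_dag_supported _ _ irr gs) mulmxDl.
      by rewrite -mulmxA Aw mulmx0 addr0 -scalemxAl yw scalemx1.
    split=> [i _ k _|] /=.
      rewrite [_ *m P i]mulmxA mulmxBr mulmx1 [_ *m (w i *m _)]mulmxA gYw mul_scalar_mx.
      rewrite (row_mul_dag_supported _ _ irr gs) addrAC subrr add0r -mulmxA.
      by rewrite mulmx_coker mulmx0 mxE.
    rewrite -[RHS]detg [RHS](det_dag_supported e_tdag gs); apply: eq_bigr => i _.
    by rewrite gYw mxE eqxx.
  pose a i := (row i Z *m w i) 0 0.
  have /choice[c Zc] i : exists c : 'rV[R]_m,
      row i Z = a i *: row i Y + c *m parent_rows e Y i.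
    have /submxP[c cP] : (row i Z - a i *: row i Y <= parent_rows e Y i)%MS.
      rewrite submxE -mul_scalar_mx -mx11_scalar -mulmxA -{1}[row i Z]mulmx1.
      by rewrite -mulmxBr -mulmxA; apply/eqP/rowP => k; rewrite [RHS]mxE; exact: ZP.
    by exists c; rewrite -cP addrC subrK.
  pose g : 'M[R]_m := \matrix_(k, j)
    (if j == k then a k else if e j k then c k 0 j else 0).
  have gs : dag_supported e g.
    by move=> k j /negPf kj /negPf ejk; rewrite mxE eq_sym kj ejk.
  have gkk k : g k k = a k by rewrite mxE eqxx.
  have detg : \det g = 1.
    rewrite (det_dag_supported e_tdag gs) -[RHS]Zw.
    by apply: eq_bigr => k _; exact: gkk.
  exists g; first by split=> //; split=> //; rewrite unitmxE detg unitr1.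
  apply/row_matrixP => i; rewrite (row_mul_dag_supported _ _ irr gs) gkk Zc.
  congr (_ + _); rewrite !mul_parent_rows; apply: eq_bigr => j eji.
  by rewrite !mxE eji; case: eqVneq eji => [->|//]; rewrite irr.
apply: closedI.
  do 2!apply: closed_bigI => ? _.
  by apply: closed_fiber; exact: row_mulmx_continuous.
apply: closed_fiber; apply: continuous_big => [|i _].
  exact: mul_continuous.
exact: row_mulmx_continuous.
Qed.

Theorem theorem5p3 (R : realType) (m n : nat) (m_gt0 : (0 < m)%N)
    (n_gt0 : (0 < n)%N) (e : rel 'I_m) (e_tdag : tdag e) (Y : 'M[R]_(m, n)) :
  ((exists i : 'I_m, row_in_parent_span e Y i) ->
     unstable (dag_group_SL (R := R) e) Y /\ likelihood_unbounded e Y) /\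
  (~ (exists i : 'I_m, row_in_parent_span e Y i) ->
     polystable (dag_group_SL (R := R) e) Y /\
     exists Psi : 'M[R]_m, is_MLE e Y Psi).
Proof.
split=> [[i yi]|/forallNP nspan].
  split; first exact: unstable_row_in_parent_span yi.
  exact: log_likelihood_unbounded yi.
split; last exact: MLE_exists.
split; last exact: closed_dag_orbit.
move=> Y0; apply: (nspan (Ordinal m_gt0)); apply/row_in_parent_spanP.
by exists 0; rewrite mul0mx Y0 row0.
Qed.
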